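(* Let $R$ be a compact discrete valuation ring. Every $R$-module homomorphism between $R$-modules equipped with their canonical topologies is continuous. In particular, the functor from the category of $R$-modules to the category of topological $R$-modules (with continuous $R$-module homomorphisms as morphisms), defined by sending an $R$-module to itself equipped with the canonical topology, is fully faithful.
   Context: A discrete valuation ring (DVR) $R$ carries the metric topology of its valuation; it is called compact if it is compact in this topology. A topological $R$-module is an $R$-module with a Hausdorff topology for which addition, inversion and scalar multiplication $R\times M\to M$ are continuous. Every finitely generated $R$-module has a unique topology making it a topological $R$-module (the product topology from any isomorphism with a finite product of modules $R/(x)$, with $R/(x)$ discrete for $x\ne 0$ and $R$ having its metric topology). The canonical topology on an arbitrary $R$-module $M$ is the direct limit topology from $M=\varinjlim_{S\leq M}S$, with $S$ running over the finitely generated submodules with their unique topologies: $U\subseteq M$ is open if and only if $U\cap S$ is open in $S$ for every finitely generated submodule $S\leq M$.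
   Formalization: Addition need not be jointly continuous in the canonical topology, so the functor is proved fully faithful on all R-modules with only separately continuous addition in the target, and into topological R-modules on any full subcategory where canonical topologies are module topologies. *)

(* Defs.v *)
From HB Require Import structures.
From mathcomp Require Import all_boot all_order all_algebra.
From mathcomp Require Import all_classical.
From mathcomp Require Import topology.
From mathcomp Require Import metric_structure.

Set Implicit Arguments.
Unset Strict Implicit.
Unset Printing Implicit Defensive.

Import Order.TTheory GRing.Theory Num.Theory.
Local Open Scope classical_set_scope.
Local Open Scope ring_scope.

(* R is a discrete valuation ring when its fraction field carries a (then
   unique) normalized discrete valuation whose valuation ring is R. The value
   at 0, which should be +oo, is left arbitrary and never used. *)
Record discrete_valuation (R : idomainType) := DiscreteValuation {
  valuation :> {fraction R} -> int;
  valuationM : forall x y, x != 0 -> y != 0 ->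
    valuation (x * y) = valuation x + valuation y;
  valuationD : forall x y, x != 0 -> y != 0 -> x + y != 0 ->
    Num.min (valuation x) (valuation y) <= valuation (x + y);
  valuation_surj : forall n : int, exists2 x, x != 0 & valuation x = n;
  valuation_ringP : forall x,
    (exists r : R, x = tofrac r) <-> x = 0 \/ 0 <= valuation x
}.

(* The base 2 is a choice; any base > 1 induces the same topology. *)
Definition valuation_dist (R : idomainType) (v : discrete_valuation R)
    (x y : R) : rat :=
  if x == y then 0 else 2%:Q ^ (- v (tofrac (x - y))).

Section ValuationDist.
Variables (R : idomainType) (v : discrete_valuation R).

Lemma valuation1 : v 1 = 0.
Proof.
have := @valuationM R v 1 1 (oner_neq0 _) (oner_neq0 _).
by rewrite mul1r => /eqP; rewrite -{1}[v 1]addr0 => /eqP/addrI <-.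
Qed.

Lemma valuationN x : x != 0 -> v (- x) = v x.
Proof.
have N10 : (-1 : {fraction R}) != 0 by rewrite oppr_eq0 oner_neq0.
move=> x0; rewrite -mulN1r valuationM//.
suff -> : v (-1) = 0 by rewrite add0r.
have := @valuationM R v _ _ N10 N10; rewrite mulrNN mulr1 valuation1.
by move/esym/eqP; rewrite -mulr2n mulrn_eq0 => /eqP.
Qed.

Lemma valuation_dist_ge0 x y : 0 <= valuation_dist v x y.
Proof. by rewrite /valuation_dist; case: eqP => // _; apply: exprz_ge0. Qed.

Lemma valuation_distxx x : valuation_dist v x x = 0.
Proof. by rewrite /valuation_dist eqxx. Qed.

Lemma valuation_dist_eq0 x y : valuation_dist v x y = 0 -> x = y.
Proof.
rewrite /valuation_dist; case: eqP => // _ /eqP.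
by rewrite expfz_eq0 andbC.
Qed.

Lemma valuation_dist_sym x y : valuation_dist v x y = valuation_dist v y x.
Proof.
rewrite /valuation_dist eq_sym; case: eqVneq => // yx.
rewrite -(opprB y x) rmorphN valuationN// tofrac_eq0 subr_eq0 //.
Qed.

Lemma valuation_dist_triangle y x z :
  valuation_dist v x z <= valuation_dist v x y + valuation_dist v y z.
Proof.
case: (eqVneq x z) => [->|xz].
  by rewrite valuation_distxx addr_ge0 ?valuation_dist_ge0.
case: (eqVneq x y) => [->|xy]; first by rewrite valuation_distxx add0r.
case: (eqVneq y z) => [->|yz]; first by rewrite valuation_distxx addr0.
have nz (a b : R) : a != b -> tofrac (a - b) != 0.
  by rewrite tofrac_eq0 subr_eq0.
have xzE : tofrac (x - z) = tofrac (x - y) + tofrac (y - z).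
  by rewrite -rmorphD addrA subrK.
have := @valuationD R v _ _ (nz _ _ xy) (nz _ _ yz); rewrite -xzE.
move=> /(_ (nz _ _ xz)); rewrite ge_min /valuation_dist.
rewrite (negbTE xz) (negbTE xy) (negbTE yz) => /orP[le|le].
  by apply: ler_wpDr; [exact: exprz_ge0 | rewrite ler_eXz2l// lerN2].
by apply: ler_wpDl; [exact: exprz_ge0 | rewrite ler_eXz2l// lerN2].
Qed.

End ValuationDist.

(* R as a metric space; the library derives its topology from the metric. *)
Definition metric_of (R : idomainType) (v : discrete_valuation R) : Type := R.

HB.instance Definition _ (R : idomainType) (v : discrete_valuation R) :=
  Choice.on (metric_of v).
HB.instance Definition _ (R : idomainType) (v : discrete_valuation R) :=
  isMetric.Build rat (metric_of v) (valuation_distxx v)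
    (@valuation_dist_eq0 R v) (valuation_dist_sym v)
    (valuation_dist_triangle v).

Definition compact_dvr (R : idomainType) (v : discrete_valuation R) : Prop :=
  compact [set: metric_of v].

(* Topologies as first-class objects on a fixed carrier, and the corresponding
   copy of the carrier as a library topological space. *)
Record topology (T : Type) := Topology {
  is_open :> set (set T);
  is_openT : is_open setT;
  is_openI : forall A B, is_open A -> is_open B -> is_open (A `&` B);
  is_open_bigU : forall (I : Type) (f : I -> set T),
    (forall i, is_open (f i)) -> is_open (\bigcup_i f i)
}.

Definition with_top (T : choiceType) (t : topology T) : Type := T.

HB.instance Definition _ (T : choiceType) (t : topology T) :=
  Choice.on (with_top t).
HB.instance Definition _ (T : choiceType) (t : topology T) :=
  isOpenTopological.Build (with_top t)
    (is_openT t) (@is_openI T t) (@is_open_bigU T t).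

Section ModuleTopology.
Variables (R : idomainType) (v : discrete_valuation R).
Variables (M : lmodType R) (t : topology M).

Definition add_continuous : Prop :=
  continuous (fun z : with_top t * with_top t =>
    ((z.1 : M) + (z.2 : M)) : with_top t).

Definition add_separately_continuous : Prop :=
  forall x : M, continuous (fun y : with_top t => (x + (y : M)) : with_top t).

Definition opp_continuous : Prop :=
  continuous (fun x : with_top t => (- (x : M)) : with_top t).

Definition scale_continuous : Prop :=
  continuous (fun z : metric_of v * with_top t =>
    ((z.1 : R) *: (z.2 : M)) : with_top t).

Definition module_topology : Prop :=
  [/\ hausdorff_space (with_top t), add_continuous, opp_continuous
    & scale_continuous].

(* As module_topology, with addition only continuous in each variable (one
   variable suffices, by commutativity). The canonical topology of a module
   that is not countably generated may fail to have a jointly continuous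
   addition. *)
Definition semimodule_topology : Prop :=
  [/\ hausdorff_space (with_top t), add_separately_continuous, opp_continuous
    & scale_continuous].

End ModuleTopology.

Record subset_submodule (R : idomainType) (M : lmodType R) := SubsetSubmodule {
  submod_mem :> {pred M};
  submod_memP : submod_closed submod_mem
}.

Section Submodule.
Variables (R : idomainType) (M : lmodType R) (S : subset_submodule M).

HB.instance Definition _ :=
  GRing.isSubmodClosed.Build R M (submod_mem S) (submod_memP S).

Record submodule := Submodule { subval :> M; subvalP : subval \in S }.

HB.instance Definition _ := [isSub for subval].
HB.instance Definition _ := [Choice of submodule by <:].
HB.instance Definition _ := [SubChoice_isSubZmodule of submodule by <:].
HB.instance Definition _ := [SubZmodule_isSubLmodule of submodule by <:].

End Submodule.

Definition finitely_generated (R : idomainType) (M : lmodType R) : Prop :=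
  exists (n : nat) (g : 'I_n -> M), forall x : M,
    exists c : 'I_n -> R, x = \sum_(i < n) c i *: g i.

(* Over a compact R a finitely generated module S has exactly one module
   topology, and fg_open is its family of open sets. Quantifying universally
   over the module topologies makes fg_open a topology without first proving
   that existence and uniqueness. *)
Definition fg_open (R : idomainType) (v : discrete_valuation R)
    (S : lmodType R) (A : set S) : Prop :=
  forall t : topology S, module_topology v t -> is_open t A.

Section CanonicalTopology.
Variables (R : idomainType) (v : discrete_valuation R) (M : lmodType R).

Definition canonical_open (U : set M) : Prop :=
  forall S : subset_submodule M, finitely_generated (submodule S) ->
    fg_open v [set x : submodule S | U (subval x)].

Lemma canonical_openT : canonical_open setT.
Proof. by move=> S _ t _; exact: is_openT. Qed.

Lemma canonical_openI A B :
  canonical_open A -> canonical_open B -> canonical_open (A `&` B).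
Proof.
by move=> oA oB S fgS t mt; apply: is_openI; [exact: oA | exact: oB].
Qed.

Lemma canonical_open_bigU (I : Type) (f : I -> set M) :
  (forall i, canonical_open (f i)) -> canonical_open (\bigcup_i f i).
Proof.
move=> of_ S fgS t mt.
by apply: (@is_open_bigU _ t I (fun i => [set x | f i (subval x)])) => i;
  exact: of_.
Qed.

Definition canonical_topology : topology M :=
  Topology canonical_openT canonical_openI canonical_open_bigU.

End CanonicalTopology.

Record category := Category {
  obj :> Type;
  hom : obj -> obj -> Type;
  idm : forall a, hom a a;
  hom_comp : forall a b c, hom b c -> hom a b -> hom a c;
  comp_idl : forall a b (f : hom a b), hom_comp (idm b) f = f;
  comp_idr : forall a b (f : hom a b), hom_comp f (idm a) = f;
  comp_assoc : forall a b c d (h : hom c d) (g : hom b c) (f : hom a b),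
    hom_comp h (hom_comp g f) = hom_comp (hom_comp h g) f
}.

Record functor (C D : category) := Functor {
  fobj :> C -> D;
  fmap : forall a b : C, hom a b -> hom (fobj a) (fobj b);
  fmap_id : forall a : C, fmap (idm a) = idm (fobj a);
  fmap_comp : forall (a b c : C) (g : hom b c) (f : hom a b),
    fmap (hom_comp g f) = hom_comp (fmap g) (fmap f)
}.

Definition fully_faithful (C D : category) (F : functor C D) : Prop :=
  forall a b : C, bijective (@fmap C D F a b).

Definition full_subcategory (C : category) (P : C -> Prop) : category :=
  @Category {x : C | P x} (fun a b => hom (sval a) (sval b))
    (fun a => idm (sval a)) (fun a b c g f => hom_comp g f)
    (fun a b f => comp_idl f) (fun a b f => comp_idr f)
    (fun a b c d h g f => comp_assoc h g f).

Definition restrict_functor (C D : category) (F : functor C D) (P : C -> Prop) :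
    functor (full_subcategory P) D :=
  @Functor (full_subcategory P) D (fun a => F (sval a))
    (fun a b f => fmap F f) (fun a => fmap_id F (sval a))
    (fun a b c g f => fmap_comp F g f).

Definition corestrict_functor (C D : category) (F : functor C D) (Q : D -> Prop)
    (FQ : forall a : C, Q (F a)) : functor C (full_subcategory Q) :=
  @Functor C (full_subcategory Q) (fun a => exist Q (F a) (FQ a))
    (fun a b f => fmap F f) (fun a => fmap_id F a)
    (fun a b c g f => fmap_comp F g f).

Lemma linear_ext (R : idomainType) (M N : lmodType R) (f g : {linear M -> N}) :
  f =1 g -> f = g.
Proof.
case: f g => [f cf] [g cg] /= /funext fg; move: cf cg; rewrite {}fg => cf cg.
congr GRing.Linear.Pack.
case: cf cg => [[a1] [a2]] [[b1] [b2]].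
by congr GRing.Linear.Class; [congr GRing.isNmodMorphism.Axioms_ |
  congr GRing.isScalable.Axioms_]; exact: Prop_irrelevance.
Qed.

Section ModuleCategories.
Variables (R : idomainType) (v : discrete_valuation R).

Definition linear_id (M : lmodType R) : {linear M -> M} := idfun.

Definition linear_comp (M N P : lmodType R) (g : {linear N -> P})
  (f : {linear M -> N}) : {linear M -> P} := g \o f.

Definition module_category : category.
Proof.
refine (@Category (lmodType R) (fun M N => {linear M -> N})
  linear_id linear_comp _ _ _).
- by move=> M N f; exact: linear_ext.
- by move=> M N f; exact: linear_ext.
- by move=> M N P Q h g f; exact: linear_ext.
Defined.

Record topologized_module := TopologizedModule {
  tm_module :> lmodType R;
  tm_topology : topology tm_module
}.

Definition linear_continuous (M N : topologized_module)
    (f : {linear M -> N}) : Prop :=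
  continuous (f : with_top (tm_topology M) -> with_top (tm_topology N)).

Lemma linear_continuous_id (M : topologized_module) :
  linear_continuous (linear_id M : {linear M -> M}).
Proof. by move=> x; exact: cvg_id. Qed.

Lemma linear_continuous_comp (M N P : topologized_module)
    (g : {linear N -> P}) (f : {linear M -> N}) :
  linear_continuous g -> linear_continuous f ->
  linear_continuous (linear_comp g f : {linear M -> P}).
Proof. by move=> cg cf x; exact: cvg_comp (cf x) (cg (f x)). Qed.

Definition continuous_hom (M N : topologized_module) :=
  {f : {linear M -> N} | linear_continuous f}.

Lemma continuous_hom_ext (M N : topologized_module)
    (f g : continuous_hom M N) : sval f = sval g -> f = g.
Proof. by case: f g => [f cf] [g cg]; exact: eq_exist. Qed.

(* No compatibility between topology and module structure is required of the
   objects here; the categories of topological R-modules are full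
   subcategories of this one. *)
Definition topologized_module_category : category.
Proof.
refine (@Category topologized_module continuous_hom
  (fun M => exist _ (linear_id M) (@linear_continuous_id M))
  (fun M N P g f => exist _ (linear_comp (sval g) (sval f))
    (linear_continuous_comp (proj2_sig g) (proj2_sig f))) _ _ _).
- by move=> M N f; apply: continuous_hom_ext; exact: linear_ext.
- by move=> M N f; apply: continuous_hom_ext; exact: linear_ext.
- by move=> M N P Q h g f; apply: continuous_hom_ext; exact: linear_ext.
Defined.

Definition topological_module : topologized_module_category -> Prop :=
  fun M => module_topology v (tm_topology M).

Definition semitopological_module : topologized_module_category -> Prop :=
  fun M => semimodule_topology v (tm_topology M).

Definition canonical_module (M : lmodType R) : topologized_module :=
  TopologizedModule (canonical_topology v M).

Definition homs_continuous : Prop :=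
  forall (M N : lmodType R) (f : {linear M -> N}),
    continuous (f : with_top (canonical_topology v M) ->
                    with_top (canonical_topology v N)).

Definition canonical_functor (homs_cont : homs_continuous) :
  functor module_category topologized_module_category.
Proof.
refine (@Functor module_category topologized_module_category
  canonical_module (fun M N f => exist _ f (homs_cont M N f)) _ _).
- by move=> M; exact: continuous_hom_ext.
- by move=> M N P g f; exact: continuous_hom_ext.
Defined.

End ModuleCategories.

(* Main.v *)
Require Import Defs.
From mathcomp Require Import all_boot all_order all_algebra.
From HB Require Import structures.
From mathcomp Require Import all_classical.
From mathcomp Require Import topology.
From mathcomp Require Import metric_structure.

(** The open sets of the canonical topology have a description that mentions
    no topology on any submodule: [U] is open if and only if, for each point
    [x] of [U] and each finite family [g], it contains [x + r S] for some
    nonzero [r], where [S] is the span of [g] ([finitely_open]).  Granted this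
    (the lemma [canonical_openE]), homomorphisms are continuous for the trivial
    reason that they send spans of finite families to spans of finite families,
    and full faithfulness follows since every homomorphism is a morphism of the
    target category, in exactly one way.

    For [canonical_openE] a module topology [t] on a finitely generated module
    [S] has to be compared with the finitely open one.
    - Finitely open sets are open for [t]: [S] is the image of a finite power
      of [R], which is compact, so the surjection onto the Hausdorff space [S]
      is closed ([finitely_open_is_open]).
    - Conversely it is enough that the finitely open topology of [S] is itself
      a module topology ([finite_topology_module]).

    The separation axiom holds on every module.  Cosets of a submodule with
    torsion quotient are finitely open, and Zorn's lemma yields such a submodule
    avoiding any given nonzero element ([cotorsion_separation]); this replaces
    the structure theory of finitely generated modules.  Joint continuity of
    scalar multiplication also holds on every module, by the compactness of [R]
    used in the form [compact_uniform].  Thus the canonical topology is always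
    a semimodule topology; the joint continuity of addition on [S] comes from
    finite generation, which makes one and the same neighborhood [r S] available
    at all points. *)

Set Implicit Arguments.
Unset Strict Implicit.
Unset Printing Implicit Defensive.

Import Order.TTheory GRing.Theory Num.Theory.
Local Open Scope classical_set_scope.
Local Open Scope ring_scope.

(** * Arithmetic and topology of a discrete valuation ring *)

Section ValuationRing.
Variables (R : idomainType) (v : discrete_valuation R).

Lemma valuation_ge0 (r : R) : r != 0 -> 0 <= v (tofrac r).
Proof.
move=> r0; have /(valuation_ringP v) [/eqP|//] : exists s, tofrac r = tofrac s.
  by exists r.
by rewrite tofrac_eq0 (negPf r0).
Qed.

(** A discrete valuation ring is a chain ring: divisibility is comparison of
    valuations. *)
Lemma valuation_le_divides (r s : R) : r != 0 -> s != 0 ->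
  v (tofrac r) <= v (tofrac s) -> exists b, s = r * b.
Proof.
move=> r0 s0 le_rs; have fr0 : tofrac r != 0 by rewrite tofrac_eq0.
have q0 : tofrac s / tofrac r != 0 by rewrite mulf_neq0 ?invr_eq0 ?tofrac_eq0.
have vq : v (tofrac s) = v (tofrac s / tofrac r) + v (tofrac r).
  by rewrite -valuationM// divfK.
have /(valuation_ringP v) [b bE] : tofrac s / tofrac r = 0
    \/ 0 <= v (tofrac s / tofrac r).
  by right; rewrite -(lerD2r (v (tofrac r))) add0r -vq.
exists b; apply/eqP; rewrite -tofrac_eq rmorphM/= -bE mulrC divfK//.
Qed.

Lemma exists_valuation (n : nat) : exists2 r : R, r != 0 & v (tofrac r) = n.
Proof.
have [x x0 vx] := valuation_surj v n.
have /(valuation_ringP v) [r rE] : x = 0 \/ 0 <= v x by right; rewrite vx.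
by exists r; rewrite -?rE// -tofrac_eq0 -rE.
Qed.

(** Any element [p] of positive valuation will do: then [1 - p * b] has
    valuation [0], so it is a unit. *)
Lemma exists_nonzero_in_radical :
  exists2 p : R, p != 0 & forall b, exists u, u * (1 - p * b) = 1.
Proof.
have [p p0 vp] := exists_valuation 1; exists p => // b.
have [->|b0] := eqVneq b 0; first by exists 1; rewrite mulr0 subr0 mulr1.
have vpb : 0 < v (tofrac (p * b)).
  by rewrite rmorphM/= valuationM ?tofrac_eq0// vp ltr_wpDr ?valuation_ge0.
have pb0 : p * b != 0 by rewrite mulf_neq0.
have w0 : 1 - p * b != 0.
  apply: contraTneq vpb => /eqP; rewrite subr_eq0 => /eqP <-.
  by rewrite rmorph1 valuation1 ltxx.
have le0 : v (tofrac (1 - p * b)) <= 0.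
  have := @valuationD R v (tofrac (1 - p * b)) (tofrac (p * b)).
  rewrite -rmorphD subrK rmorph1 oner_neq0 !tofrac_eq0 w0 pb0 valuation1.
  by move=> /(_ isT isT isT); rewrite ge_min [X in _ || X]leNgt vpb orbF.
have [u uE] : exists u, 1 = (1 - p * b) * u.
  by apply: valuation_le_divides; rewrite ?oner_neq0// rmorph1 valuation1.
by exists u; rewrite mulrC -uE.
Qed.

(** The metric enters only through this lemma: the nonzero ideals form a base
    of neighborhoods of [0], since valuations of nonzero elements of [R] take
    all natural values and a closed ball about [0] is a principal ideal. *)
Lemma nbhs_metricP (a : R) (U : set R) :
  nbhs (a : metric_of v) (U : set (metric_of v)) <->
  exists2 r : R, r != 0 & forall b, U (a + r * b).
Proof.
split=> [/nbhs_ballP[e /= e0 aeU]|[r r0 arU]].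
- have [n len] : exists n : nat, 2%:Q ^ (- n%:Z) < e.
    exists (Num.bound e^-1); rewrite -invr_expz -[ltRHS]invrK.
    rewrite ltf_pV2 ?posrE ?invr_gt0 ?exprz_gt0//.
    apply: lt_le_trans (archi_boundP _) _; first by rewrite invr_ge0 ltW.
    by rewrite -exprnP -natrX ler_nat ltnW// ltn_expl.
  have [r r0 vr] := exists_valuation n; exists r => // b.
  (* [2 ^ (- n)] bounds the distance from [a] to any point of [a + r R]. *)
  apply: aeU; rewrite ballEmdist/=; apply: le_lt_trans len.
  rewrite /mdist/= /valuation_dist; case: eqVneq => [_|ab].
    by rewrite exprz_ge0.
  have b0 : - b != 0.
    apply: contraNneq ab => /eqP; rewrite oppr_eq0 => /eqP->.
    by rewrite mulr0 addr0.
  rewrite ler_eXz2l// lerN2 opprD addNKr -mulrN rmorphM/=.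
  by rewrite valuationM ?tofrac_eq0// vr lerDl valuation_ge0.
- apply/nbhs_ballP; exists (2%:Q ^ (- v (tofrac r))) => /=.
    by rewrite exprz_gt0.
  move=> y; rewrite ballEmdist/= /mdist/= /valuation_dist.
  case: eqVneq => [<- _|ay]; first by rewrite -[a]addr0 -(mulr0 r).
  rewrite ltr_eXz2l// ltrN2 => /ltW.
  have ay0 : a - y != 0 by rewrite subr_eq0.
  move=> /(valuation_le_divides r0 ay0) [b bE].
  by have := arU (- b); rewrite mulrN -bE opprB addrC subrK.
Qed.

End ValuationRing.

(** * Finitely generated spans and torsion quotients *)

Lemma subval_sum (R : idomainType) (M : lmodType R) (S : subset_submodule M)
    n (c : 'I_n -> R) (h : 'I_n -> submodule S) :
  subval (\sum_(i < n) c i *: h i) = \sum_(i < n) c i *: subval (h i).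
Proof. by rewrite -[subval _]/(\val _) raddf_sum; exact: eq_bigr. Qed.

Section Span.
Variables (R : idomainType) (M : lmodType R) (n : nat) (g : 'I_n -> M).

Definition span : {pred M} :=
  fun x => `[< exists c : 'I_n -> R, x = \sum_(i < n) c i *: g i >].

Lemma spanP x :
  reflect (exists c : 'I_n -> R, x = \sum_(i < n) c i *: g i) (x \in span).
Proof. exact: asboolP. Qed.

Lemma span_submod : submod_closed span.
Proof.
split.
  by apply/spanP; exists (fun=> 0); rewrite big1// => i _; rewrite scale0r.
move=> a _ _ /spanP[c ->] /spanP[d ->]; apply/spanP.
exists (fun i => a * c i + d i); rewrite scaler_sumr -big_split/=.
by apply: eq_bigr => i _; rewrite scalerDl scalerA.
Qed.

HB.instance Definition _ := GRing.isSubmodClosed.Build R M span span_submod.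

Lemma mem_span i : g i \in span.
Proof.
apply/spanP; exists (fun j => (j == i)%:R); rewrite (bigD1 i)//= eqxx scale1r.
by rewrite big1 ?addr0// => j /negPf ->; rewrite scale0r.
Qed.

Lemma fg_span : finitely_generated (submodule (SubsetSubmodule span_submod)).
Proof.
exists n, (fun i => Submodule (mem_span i : _ \in SubsetSubmodule span_submod)).
move=> [x xg]; have /spanP[c xE] := xg; exists c; apply: val_inj => /=.
by rewrite subval_sum.
Qed.

End Span.

(** Enlarging a family by one vector lets openness be tested along the span of
    a point together with given directions. *)
Definition cons_family (M : Type) (n : nat) (x : M) (g : 'I_n -> M)
  (i : 'I_n.+1) : M := if unlift ord0 i is Some j then g j else x.

Lemma span_consl (R : idomainType) (M : lmodType R) n (x : M) (g : 'I_n -> M) :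
  x \in span (cons_family x g).
Proof.
by have := mem_span (cons_family x g) ord0; rewrite /cons_family unlift_none.
Qed.

Lemma span_consr (R : idomainType) (M : lmodType R) n (x : M) (g : 'I_n -> M) :
  {subset span g <= span (cons_family x g)}.
Proof.
move=> _ /spanP[c ->]; apply: rpred_sum => i _; apply: rpredZ.
by have := mem_span (cons_family x g) (lift ord0 i); rewrite /cons_family liftK.
Qed.

Section TorsionQuotient.
Variables (R : idomainType) (M : lmodType R).

(** [L] is a submodule and [M / L] is torsion; on finitely generated modules
    over a discrete valuation ring these are the open submodules. *)
Definition cotorsion (L : set M) : Prop :=
  [/\ L 0, forall a x y, L x -> L y -> L (a *: x + y)
    & forall y, exists2 r : R, r != 0 & L (r *: y)].

(** The product of multipliers for the members of the family works. *)
Lemma cotorsion_span (L : set M) n (g : 'I_n -> M) : cotorsion L ->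
  exists2 r : R, r != 0 & forall y, y \in span g -> L (r *: y).
Proof.
move=> [L0 Llin Ltor].
have /choice[r rP] (i : 'I_n) : exists r : R, r != 0 /\ L (r *: g i).
  by have [r ? ?] := Ltor (g i); exists r.
exists (\prod_i r i); first by apply/prodf_neq0 => i _; case: (rP i).
have Ladd x y : L x -> L y -> L (x + y).
  by rewrite -{2}[x]scale1r; exact: Llin.
have Lscale a x : L x -> L (a *: x).
  by rewrite -[a *: x]addr0 => Lx; exact: Llin.
move=> _ /spanP[c ->]; rewrite scaler_sumr; apply: (big_ind L) => // i _.
rewrite (bigD1 i)//= scalerA mulrAC -mulrA mulrC -scalerA.
by apply: Lscale; case: (rP i).
Qed.

(** By Zorn's lemma take [L] maximal among the submodules that avoid [z].
    For [y] outside [L], maximality gives [z = x + r y] with [x] in [L], so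
    every nonzero submodule of [M / L] contains the class of [z].  If [p] is in
    the radical then [p z] lies in [L], since otherwise [z = x + b p z]
    and [1 - b p] is a unit; hence [p r y = p z - p x] lies in [L]. *)
Lemma cotorsion_separation (v : discrete_valuation R) (z : M) : z != 0 ->
  exists2 L : set M, cotorsion L & ~ L z.
Proof.
move=> z0.
pose P (L : set M) := (forall a x y, L x -> L y -> L (a *: x + y)) /\ ~ L z.
have [|L [[Llin Lz] Lmax]] := @Zorn_bigcup M P.
  move=> F FP Ftot; split; last by move=> [X /FP[_ nXz] /nXz].
  move=> a x y [X FX Xx] [Y FY Yy].
  have [XY|YX] := Ftot _ _ FX FY.
    by exists Y => //; apply: (FP _ FY).1 => //; exact: XY.
  by exists X => //; apply: (FP _ FX).1 => //; exact: YX.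
have L0 : L 0.
  have [|/nonemptyPn Le] := pselect (L !=set0).
    by move=> [x Lx]; rewrite -(subrr x) addrC -scaleN1r; exact: Llin.
  exfalso; apply: (Lmax [set 0]).
    by rewrite Le; split => // /(_ 0); apply.
  by split => [a x y -> ->|/eqP]; rewrite ?scaler0 ?addr0// (negPf z0).
have Lscale a x : L x -> L (a *: x).
  by rewrite -[a *: x]addr0 => Lx; exact: Llin.
have Lmaxz y : ~ L y -> exists x r, L x /\ z = x + r *: y.
  move=> Ly; apply: contrapT => nz.
  apply: (Lmax [set w | exists x r, L x /\ w = x + r *: y]).
    split=> [w Lw|/(_ y)].
      by exists w, 0; rewrite scale0r addr0.
    by move=> sub; apply/Ly/sub; exists 0, 1; rewrite add0r scale1r.
  split=> // a _ _ [x1 [r1 [Lx1 ->]]] [x2 [r2 [Lx2 ->]]].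
  exists (a *: x1 + x2), (a * r1 + r2); split; first exact: Llin.
  by rewrite scalerDr scalerDl scalerA addrACA.
have [p p0 p_rad] := exists_nonzero_in_radical v.
have Lpz : L (p *: z).
  apply: contrapT => /Lmaxz[x [b [Lx zE]]]; apply: Lz.
  have [u uE] := p_rad b; rewrite -[z]scale1r -uE -scalerA; apply: Lscale.
  by rewrite scalerBl scale1r {1}zE scalerA mulrC addrK.
exists L => //; split=> // y.
have [Ly|/Lmaxz[x [r [Lx zE]]]] := pselect (L y).
  by exists 1; rewrite ?oner_neq0// scale1r.
have r0 : r != 0.
  by apply: contra_notN Lz => /eqP r0; rewrite zE r0 scale0r addr0.
exists (p * r); first exact: mulf_neq0.
suff -> : (p * r) *: y = - p *: x + p *: z by exact: Llin.
by rewrite zE scalerDr scaleNr addKr scalerA.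
Qed.

End TorsionQuotient.

(** * The finitely open topology *)

Section FinitelyOpen.
Variables (R : idomainType) (M : lmodType R).

(** The point [x] need not lie in the span of [g]; this builds invariance under
    translation into the definition.  No valuation or metric is mentioned:
    nonzero ideals play the role of neighborhoods of [0] in [R]. *)
Definition finitely_open (U : set M) : Prop :=
  forall x, U x -> forall n (g : 'I_n -> M),
    exists2 r : R, r != 0 & forall y, y \in span g -> U (x + r *: y).

Lemma finitely_openT : finitely_open setT.
Proof. by move=> x _ n g; exists 1; rewrite ?oner_neq0. Qed.

Lemma finitely_openI A B :
  finitely_open A -> finitely_open B -> finitely_open (A `&` B).
Proof.
move=> oA oB x [Ax Bx] n g.
have [r r0 rA] := oA x Ax n g; have [s s0 sB] := oB x Bx n g.
exists (r * s) => [|y yg]; first exact: mulf_neq0.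
(* [r s y] is [r] times [s y], and also [s] times [r y]. *)
split; first by rewrite -scalerA; apply/rA/rpredZ.
by rewrite mulrC -scalerA; apply/sB/rpredZ.
Qed.

Lemma finitely_open_bigU (I : Type) (f : I -> set M) :
  (forall i, finitely_open (f i)) -> finitely_open (\bigcup_i f i).
Proof.
move=> of_ x [i _ fix_] n g; have [r r0 rf] := of_ i x fix_ n g.
by exists r => // y /rf; exists i.
Qed.

Definition finite_topology : topology M :=
  Topology finitely_openT finitely_openI finitely_open_bigU.

Lemma finitely_open_translate (x : M) (U : set M) :
  finitely_open U -> finitely_open [set y | U (x + y)].
Proof.
move=> oU y Uxy n g; have [r r0 rU] := oU _ Uxy n g.
by exists r => // w /rU; rewrite /= addrA.
Qed.

Lemma finitely_open_coset (L : set M) (x : M) :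
  cotorsion L -> finitely_open [set y | L (y - x)].
Proof.
move=> Lc y Lyx n g; have [r r0 rL] := cotorsion_span g Lc.
have [_ Llin _] := Lc.
exists r => // w /rL Lw.
by rewrite /= addrAC addrC -(scale1r (r *: w)); exact: Llin.
Qed.

End FinitelyOpen.

Lemma finitely_open_preimage (R : idomainType) (M N : lmodType R)
    (f : {linear M -> N}) (U : set N) :
  finitely_open U -> finitely_open (f @^-1` U).
Proof.
move=> oU x Ux n g; have [r r0 rU] := oU _ Ux n (f \o g).
exists r => // _ /spanP[c ->]; rewrite /= linearD linearZ linear_sum /=.
apply: rU; apply/spanP; exists c; apply: eq_bigr => i _; exact: linearZ.
Qed.

(** * The finitely open topology is a semimodule topology *)

Section FiniteTopology.
Variables (R : idomainType) (v : discrete_valuation R).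

Lemma nbhs_with_topP (T : choiceType) (t : topology T) (x : T) (U : set T) :
  nbhs (x : with_top t) (U : set (with_top t)) <->
  exists B : set T, [/\ is_open t B, B x & B `<=` U].
Proof.
rewrite nbhsE; split=> [[B [oB Bx] BU]|[B [oB Bx BU]]]; first by exists B.
by exists B.
Qed.

(** Two points are separated by their cosets modulo a submodule with torsion
    quotient that avoids their difference. *)
Lemma finite_topology_hausdorff (M : lmodType R) :
  hausdorff_space (with_top (finite_topology M)).
Proof.
rewrite open_hausdorff => x y xy.
have [|L Lc nL] := @cotorsion_separation _ M v ((x : M) - (y : M)).
  by rewrite subr_eq0.
have [L0 Llin _] := Lc.
exists ([set w | L (w - (x : M))], [set w | L (w - (y : M))]).
  by split; apply/mem_set; rewrite /= subrr.
split; [exact: finitely_open_coset|exact: finitely_open_coset|].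
apply/eqP; rewrite -subset0 => w [/= Lwx Lwy]; apply: nL.
have -> : (x : M) - (y : M) = -1 *: ((w : M) - x) + ((w : M) - y).
  by rewrite scaleN1r opprB addrA subrK.
exact: Llin.
Qed.

Lemma finite_topology_linear_continuous (M N : lmodType R)
    (f : {linear M -> N}) :
  continuous (f : with_top (finite_topology M) -> with_top (finite_topology N)).
Proof. by apply/continuousP => A oA; exact: finitely_open_preimage. Qed.

Hypothesis R_compact : compact_dvr v.

(** A tube lemma in algebraic form: a nonzero [s] depending on [b], valid for
    its multiples and on a residue class around [b], can be chosen uniformly
    in [b]. *)
Lemma compact_uniform (P : R -> R -> Prop) :
  (forall b, exists2 s, s != 0 & forall k l, P (s * k) (b + s * l)) ->
  exists2 s, s != 0 & forall b, P s b.
Proof.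
move=> Ploc; have /compact_near_coveringP near_cov := R_compact.
have : \forall s \near nbhs (0 : metric_of v), [set: metric_of v] `<=` P s.
  apply: near_cov => b _; have [s s0 sP] := Ploc b.
  exists ([set b' | exists l, b' = b + s * l],
      [set e | exists k, e = s * k]) => /=.
    by split; apply/nbhs_metricP; exists s => // c; exists c; rewrite ?add0r.
  by move=> [_ _] [[l ->] [k ->]] /=.
move=> /nbhs_metricP[s s0 sP]; exists s => // b.
by have := sP 1; rewrite add0r mulr1; apply.
Qed.

(** Let [a x] lie in [U], with [(a + r R) x] inside [U].  The set [V] of all [y]
    with [(a + r R) y] inside [U] contains [x], and the preimage of [U] contains
    [(a + r R) * V].  That [V] is finitely open is where compactness is used:
    for each scalar [b] the openness of [U] gives an [s], and by
    [compact_uniform] one [s] serves all scalars of [a + r R]. *)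
Lemma finite_topology_scale_continuous (M : lmodType R) :
  scale_continuous v (finite_topology M).
Proof.
move=> [a x] W /nbhs_with_topP[U [oU Ux UW]].
have [r r0 rU] := oU _ Ux _ (fun _ : 'I_1 => x).
pose V := [set y : M | forall k, U ((a + r * k) *: y)].
have oV : finitely_open V.
  move=> y Vy n g.
  pose P s b := forall w, w \in span g -> U ((a + r * b) *: (y + s *: w)).
  have [|s s0 sP] := @compact_uniform P.
    move=> b; have [s s0 sU] := oU _ (Vy b) _ (cons_family y g).
    (* Perturbing the scalar moves the product in the direction of [y], hence
       the family extended by [y]. *)
    exists s => // k l w wg.
    have -> : (a + r * (b + s * l)) *: (y + (s * k) *: w) =
       (a + r * b) *: y +
         s *: ((r * l) *: y + ((a + r * (b + s * l)) * k) *: w).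
      rewrite !scalerDr !scalerA addrA -scalerDl mulrCA.
      by rewrite [r * (b + _)]mulrDr (mulrCA r s) (addrA a).
    apply: sU; apply: rpredD; apply: rpredZ; first exact: span_consl.
    exact: span_consr.
  by exists s => // w wg k; exact: sP.
exists ([set b | exists k, b = a + r * k], V) => /=.
  split; first by apply/nbhs_metricP; exists r => // b; exists b.
  apply/nbhs_with_topP; exists V; split=> // k.
  rewrite scalerDl -scalerA; apply/rU/rpredZ.
  exact: (mem_span (fun _ : 'I_1 => x) ord0).
by move=> [b y] /= [[k bE] Vy]; apply: UW; rewrite /= bE; exact: Vy.
Qed.

Lemma finite_topology_semimodule (M : lmodType R) :
  semimodule_topology v (finite_topology M).
Proof.
split.
- exact: finite_topology_hausdorff.
- by move=> x; apply/continuousP => A oA; exact: finitely_open_translate.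
- exact: (@finite_topology_linear_continuous M M -%R).
- exact: finite_topology_scale_continuous.
Qed.

(** When [g] generates [M], the sets [x + r M] are neighborhoods of [x], so the
    [r] found at [x + y] serves at [x] and at [y]. *)
Lemma finite_topology_module (M : lmodType R) : finitely_generated M ->
  module_topology v (finite_topology M).
Proof.
move=> [n [g gM]]; have spanM x : x \in span g by apply/spanP; exact: gM.
have [haus _ opp scal] := finite_topology_semimodule M; split=> //.
move=> [x y] W /nbhs_with_topP[U [oU Uxy UW]].
have [r r0 rU] := oU _ Uxy _ g.
pose N z := [set w : M | exists e, w = z + r *: e].
have nbhsN z : nbhs (z : with_top (finite_topology M)) (N z).
  apply/nbhs_with_topP; exists (N z); split=> //; last first.
    by exists 0; rewrite scaler0 addr0.
  move=> _ [e ->] m h; exists r => // f _.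
  by exists (e + f); rewrite scalerDr addrA.
exists (N x, N y) => //= -[p q] [/= [e pE] [f qE]]; apply: UW => /=.
by rewrite pE qE addrACA -scalerDr; exact: rU.
Qed.

(** * The finitely open topology is the canonical topology *)

Lemma linear_combination_continuous (M : lmodType R) (t : topology M)
    n (g : 'I_n -> M) : module_topology v t ->
  continuous ((fun c => \sum_(i < n) (c i : R) *: g i) :
    prod_topology (fun _ : 'I_n => metric_of v) -> with_top t).
Proof.
move=> [_ addc _ scalec]; apply: continuous_big => // i _ c.
move=> W /(scalec (c i, g i))[[A B] /= [cA gB] ABW].
have cA' : nbhs c (proj i @^-1` A).
  exact: (@proj_continuous 'I_n (fun=> metric_of v) i c A cA).
apply: filterS cA' => d dA; apply: (ABW (d i, g i)).
split=> /=; first exact: dA.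
exact: (@nbhs_singleton (with_top t) (g i) B gB).
Qed.

(** The complement of [A] is the image, under the surjection from a finite
    power of [R] given by generators, of a closed subset of a compact space;
    hence it is compact, and closed as [t] is Hausdorff. *)
Lemma finitely_open_is_open (M : lmodType R) (t : topology M) (A : set M) :
  finitely_generated M -> module_topology v t -> finitely_open A ->
  is_open t A.
Proof.
move=> [n [g gM]] tM oA; have [haus _ _ _] := tM.
pose comb (c : prod_topology (fun _ : 'I_n => metric_of v)) : with_top t :=
  \sum_(i < n) (c i : R) *: g i.
have comb_cont : continuous comb by exact: linear_combination_continuous.
pose K := comb @^-1` (~` A).
have cK : closed K.
  apply: open_closedC; rewrite openE => c Ac.
  have [r r0 rA] := oA _ Ac n g.
  have : \forall d \near c, forall i, exists b, d i = (c i : R) + r * b.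
    apply: (@filter_forall _ _ (fun i d => exists b, d i = (c i : R) + r * b)
      (nbhs c) (nbhs_filter c)) => i.
    apply: (@proj_continuous 'I_n (fun=> metric_of v) i c
      [set a : R | exists b, a = (c i : R) + r * b]).
    by apply/nbhs_metricP; exists r => // b; exists b.
  apply: filterS => d /choice[b db].
  have -> : comb d = (comb c : M) + r *: \sum_(i < n) b i *: g i.
    rewrite scaler_sumr -big_split; apply: eq_bigr => i _.
    by rewrite db scalerDl scalerA.
  by apply: rA; apply/spanP; exists b.
have kK : compact K.
  apply: (subclosed_compact cK (@tychonoff _ _ (fun=> setT) (fun=> R_compact))).
  by move=> c _ i.
have AE : ~` (comb @` K) = A.
  apply/seteqP; split=> x.
    have [c ->] := gM x; move=> ncK; apply: contrapT => nA; apply: ncK.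
    by exists c.
  by move=> Ax [c nA cx]; apply: nA; rewrite /= cx.
rewrite -AE; apply: (@closed_openC (with_top t)); apply: compact_closed => //.
by apply: continuous_compact => //; exact: continuous_subspaceT.
Qed.

(** From left to right, canonical openness is tested on the span of [x] and
    [g], for its finitely open topology, which is a module topology; from right
    to left, [finitely_open_is_open] applies to the trace of [U] on each
    finitely generated submodule. *)
Lemma canonical_openE (M : lmodType R) :
  @canonical_open R v M = @finitely_open R M.
Proof.
apply/seteqP; split=> U oU.
  move=> x Ux n g; have Sfg := fg_span (cons_family x g).
  have := oU _ Sfg _ (finite_topology_module Sfg).
  have xS := span_consl x g.
  pose S := SubsetSubmodule (span_submod (cons_family x g)).
  have [m [h hS]] := Sfg.
  move=> /(_ (Submodule (xS : x \in S)) Ux m h)[r r0 rU].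
  exists r => // y yg; have yS := span_consr x yg.
  by apply: (rU (Submodule (yS : y \in S))); apply/spanP; exact: hS.
move=> S Sfg t tS; apply: finitely_open_is_open => // x Ux n g.
have [r r0 rU] := oU _ Ux n (fun i => subval (g i)).
exists r => // y /spanP[c ->]; apply: rU; apply/spanP; exists c.
exact: subval_sum.
Qed.

(** An equality of topologies, and not merely of their open sets, transports
    continuity and the semimodule axioms by rewriting. *)
Lemma canonical_topologyE (M : lmodType R) :
  canonical_topology v M = finite_topology M.
Proof.
rewrite /canonical_topology /finite_topology.
move: (@canonical_openT _ _ _) (@canonical_openI _ _ _)
  (@canonical_open_bigU _ _ _); rewrite canonical_openE => oT oI oU.
by congr Topology; exact: Prop_irrelevance.
Qed.

End FiniteTopology.

(** * Continuity of homomorphisms and full faithfulness *)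

(* The second conjunct is the paper's functor, with target the topological
   R-modules, on any full subcategory P of modules whose canonical topology is
   a module topology; the first one is the functor on all R-modules. *)
Theorem theorem2p6 (R : idomainType) (v : discrete_valuation R)
    (R_compact : compact_dvr v) :
  exists homs_cont : homs_continuous v,
    (exists canonical_semi : forall M : module_category R,
       semitopological_module v (canonical_functor homs_cont M),
       fully_faithful (corestrict_functor canonical_semi)) /\
    (forall (P : module_category R -> Prop)
       (canonical_top : forall M : full_subcategory P,
          topological_module v
            (restrict_functor (canonical_functor homs_cont) P M)),
       fully_faithful (corestrict_functor canonical_top)).
Proof.
have homs_cont : homs_continuous v.
  move=> M N f; rewrite !canonical_topologyE//.
  exact: finite_topology_linear_continuous.
exists homs_cont; split.
  unshelve eexists.
    move=> M; rewrite /semitopological_module /= canonical_topologyE//.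
    exact: finite_topology_semimodule.
  by move=> M N; exists sval => // f; exact: continuous_hom_ext.
by move=> P Pt M N; exists sval => // f; exact: continuous_hom_ext.
Qed.
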